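(* Let $(H,\mathcal B)$ be an abelian rational RN-hypergroup. If $(H,\mathcal B)$ is dual-Burnside, then $\mathrm{FPdim}(H,\mathcal B)\in\mathbb Q$.
   Context: Abelian rational RN-hypergroup $(H,\mathcal B)$: a finite-dimensional commutative unital associative $\mathbb C$-algebra $H$ with a $\mathbb C$-basis $\mathcal B=\{x_1=1,\dots,x_m\}$, $x_ix_j=\sum_kN_{i,j}^kx_k$ with $N_{i,j}^k\in\mathbb Q_{\ge0}$, and an involution $i\mapsto i^*$ of $\{1,\dots,m\}$ such that $N_{i,i^*}^1>0$ and $N_{i,j}^1=0$ if $j\ne i^*$. Standing assumption: $x_i\mapsto x_{i^*}$ extends to an anti-involution of $H$, i.e. $N_{i,j}^k=N_{j^*,i^*}^{k^*}$. Put $h_i:=1/N_{i,i^*}^1$. $\mathrm{FPdim}:H\to\mathbb C$ is the unique algebra morphism with positive values on $\mathcal B$ ($\mathrm{FPdim}(x_i)$ is the Frobenius–Perron eigenvalue of left multiplication by $x_i$); $d_i:=\mathrm{FPdim}(x_i)$, and $\mathrm{FPdim}(H,\mathcal B):=\sum_ih_id_i^2$. $\widehat{\mathcal B}=\{\mu_1=\mathrm{FPdim},\mu_2,\dots,\mu_m\}$ is the set of all unital algebra morphisms $H\to\mathbb C$, a basis of $H^*$. Dual hypergroup: $H^*$ with basis $\widehat{\mathcal B}$, product $(f\star g)(x_i/d_i)=f(x_i/d_i)g(x_i/d_i)$ for all $i$, unit $\mu_1$, involution $\mu_{j^\#}(x_i)=\mu_j(x_{i^*})$; write $\mu_i\star\mu_j=\sum_k\widehat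 p_k(i,j)\mu_k$. $\mu_j$ is grouplike in the dual if $\mu_j\star\mu_{j^\#}=\widehat p_1(j,j^\#)\mu_1$. $(H,\mathcal B)$ is dual-Burnside if for every $\mu_j\in\widehat{\mathcal B}$: there is $x_i\in\mathcal B$ with $\mu_j(x_i)=0$ if and only if $\mu_j$ is not grouplike in the dual. *)

(* Defs.v *)
From HB Require Import structures.
From mathcomp Require Import all_boot all_order all_algebra all_field.
From mathcomp Require Import boolp classical_sets fsbigop reals complex.

Set Implicit Arguments.
Unset Strict Implicit.
Unset Printing Implicit Defensive.

Import Order.TTheory GRing.Theory Num.Theory.

Local Open Scope ring_scope.
Local Open Scope classical_set_scope.

(* The basis x_1 = 1, ..., x_m is indexed by 'I_m with m = n.+1, so that the
   index 1 of the unit becomes ord0. *)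
Record abelian_rational_RN_hypergroup
    (R : realType) (H : falgType R[i]) (n : nat) := RNHypergroup {
  hbasis : n.+1.-tuple H;
  hcoef : 'I_n.+1 -> 'I_n.+1 -> 'I_n.+1 -> rat;
  hstar : 'I_n.+1 -> 'I_n.+1;
  hmulC : forall u v : H, u * v = v * u;
  hbasisP : basis_of fullv hbasis;
  hbasis0 : tnth hbasis ord0 = 1;
  hbasisM : forall i j, tnth hbasis i * tnth hbasis j =
    \sum_k ratr (hcoef i j k) *: tnth hbasis k;
  hcoef_ge0 : forall i j k, 0 <= hcoef i j k;
  hstarK : involutive hstar;
  hcoef_star_gt0 : forall i, 0 < hcoef i (hstar i) ord0;
  hcoef_nstar : forall i j, j != hstar i -> hcoef i j ord0 = 0;
  hcoef_anti : forall i j k,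
    hcoef i j k = hcoef (hstar j) (hstar i) (hstar k)
}.

Section Hypergroup.
Variables (R : realType) (H : falgType R[i]) (n : nat).
Variable B : abelian_rational_RN_hypergroup H n.

Local Notation dual := 'Hom(H, R[i]^o).
Local Notation x := (tnth (hbasis B)).

Definition hweight (i : 'I_n.+1) : rat := (hcoef B i (hstar B i) ord0)^-1.

Definition characters : set dual := [set f | ahom_in {:H} f].

(* On R[i] the relation 0 < z means that z is real and positive. *)
Definition is_FPdim (f : dual) : Prop :=
  characters f /\ forall i, 0 < (f (x i) : R[i]).

(* By the Perron-Frobenius theorem exactly one f satisfies is_FPdim, so the
   default value 0 is never used. *)
Definition FPdim : dual := xget 0 [set f | is_FPdim f].

Definition hdim (i : 'I_n.+1) : R[i] := FPdim (x i).

Definition FPdim_total : R[i] := \sum_i ratr (hweight i) * hdim i ^+ 2.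

Definition dual_ext (a : 'I_n.+1 -> R[i]) : dual :=
  linfun (fun v : H => \sum_i coord (hbasis B) i v * a i : R[i]^o).

Lemma dual_extE a i : dual_ext a (x i) = a i.
Proof.
rewrite /dual_ext; set f := fun v : H => _.
have f_lin : linear f.
  move=> c u v; rewrite /f scaler_sumr -big_split /=; apply: eq_bigr => k _.
  by rewrite linearD linearZ /= mulrDl -mulrA.
pose fL := GRing.isLinear.Build R[i] H R[i]^o _ f f_lin.
pose F : {linear H -> R[i]^o} := HB.pack f fL.
rewrite -[f]/(F : H -> _) lfunE /= /f (bigD1 i) //=.
rewrite (tnth_nth 0) coord_free ?(basis_free (hbasisP B)) // eqxx mul1r.
rewrite big1 ?addr0 // => k ki.
rewrite coord_free ?(basis_free (hbasisP B)) //.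
by rewrite eq_sym (negPf ki) mul0r.
Qed.

Definition dual_mul (f g : dual) : dual :=
  dual_ext (fun i => hdim i *
    (f ((hdim i)^-1 *: x i) * g ((hdim i)^-1 *: x i))).

Lemma dual_mulE f g i : hdim i != 0 ->
  dual_mul f g ((hdim i)^-1 *: x i) =
  f ((hdim i)^-1 *: x i) * g ((hdim i)^-1 *: x i).
Proof. by move=> di; rewrite linearZ /= dual_extE; apply: mulKf. Qed.

Definition dual_star (f : dual) : dual :=
  dual_ext (fun i => f (x (hstar B i))).

(* The coefficients of the expansion of f * g in the basis of characters; they
   are indexed by characters and their values elsewhere are irrelevant. *)
Definition dual_coef (f g : dual) : dual -> R[i] :=
  xget (fun=> 0)
    [set p | dual_mul f g = \sum_(h \in characters) p h *: h].

Definition dual_grouplike (f : dual) : Prop :=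
  dual_mul f (dual_star f) = dual_coef f (dual_star f) FPdim *: FPdim.

Definition dual_Burnside : Prop :=
  forall f, characters f -> (exists i, f (x i) = 0) <-> ~ dual_grouplike f.

End Hypergroup.

(* Main.v *)
(* Let d_i be the values of FPdim and let z be a primitive element of the number
   field Q(d_1, ..., d_m), say d_i = q_i(z), with minimal polynomial p. As the
   structure constants are rational, every complex root w of p yields a
   character x_i |-> q_i(w), a Galois conjugate of FPdim, and it vanishes nowhere
   because p is irreducible. By the dual-Burnside property it is grouplike in
   the dual, which means q_i(w) q_j(w) = d_i ^ 2 where x_j is the dual of x_i.
   Hence the sum g of the h_i q_i q_j takes the value FPdim(H, B) at all roots
   of p; reduced modulo the separable polynomial p, g has degree smaller than
   the number of these roots, so it is a rational constant. *)

Require Import Defs.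
From mathcomp Require Import all_boot all_order all_algebra all_field.
From mathcomp Require Import boolp classical_sets reals complex.
From mathcomp Require Import ring.
From mathcomp Require polyorder.

Set Implicit Arguments.
Unset Strict Implicit.
Unset Printing Implicit Defensive.

Import Order.TTheory GRing.Theory Num.Theory.

Local Open Scope ring_scope.

(** Take a nonzero [p] of least size vanishing at [z]: if [q] vanishes at [z], so does its remainder
    modulo [p], which is therefore zero. *)
Lemma exists_minpoly (F L : fieldType) (iota : {rmorphism F -> L}) (z : L) :
    algebraicOver iota z ->
  exists2 p : {poly F}, irreducible_poly p &
    forall q, root (map_poly iota q) z = (p %| q).
Proof.
case=> p0 nz_p0 p0z.
pose P k := `[< exists q : {poly F},
  [/\ q != 0, root (map_poly iota q) z & size q = k] >].
have exP : exists k, P k by exists (size p0); apply/asboolP; exists p0.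
case: (ex_minnP exP) => k /asboolP[p [nz_p pz <-]] p_min {k}.
have p_le q : root (map_poly iota q) z -> q != 0 -> (size p <= size q)%N.
  by move=> qz nz_q; apply: p_min; apply/asboolP; exists q.
exists p => [|q]; first exact/(subfx_irreducibleP pz nz_p).
apply/idP/idP => [qz|]; last first.
  by rewrite -(dvdp_map iota) => /root_dvdp; apply.
rewrite /dvdp; case: eqVneq => // nz_r.
have := ltn_modp q p; rewrite nz_p ltnNge p_le // /root.
move: qz; rewrite {1}(divp_eq q p) rmorphD rmorphM /= /root hornerD hornerM.
by rewrite (rootP pz) mulr0 add0r.
Qed.

(** Induction on [s]: [pchar0_PET] yields a combination of the new element and the previous
    generator [z] in which both are polynomials; polynomials in [z] are then rewritten by
    composition. *)
Lemma primitive_element (F L : fieldType) (iota : {rmorphism F -> L})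
    (s : seq L) :
    [pchar F] =i pred0 -> {in s, forall x, algebraicOver iota x} ->
  exists2 z, algebraicOver iota z &
    {in s, forall x, exists q, (map_poly iota q).[z] = x}.
Proof.
move=> char0; elim: s => [|x s IHs] alg_s.
  by exists 0 => //; apply: algebraic0.
have [|z alg_z gen_z] := IHs.
  by move=> y sy; apply: alg_s; rewrite inE sy orbT.
have alg_x : algebraicOver iota x by apply: alg_s; rewrite mem_head.
have [[p nz_p pz] [q nz_q qx]] := (alg_z, alg_x).
have [k [[pz' Dz] [px' Dx]]] := pchar0_PET nz_p pz nz_q qx char0.
exists (x *+ k - z).
  apply: algebraic_sub => //; rewrite -mulr_natr -(rmorph_nat iota).
  by apply: algebraic_mul => //; apply: algebraic_id.
move=> y; rewrite inE => /predU1P[->|/gen_z[r <-]]; first by exists px'.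
by exists (r \Po pz'); rewrite map_comp_poly horner_comp Dz.
Qed.

(** In characteristic 0 the derivative of [p] is nonzero and of smaller degree, so [p] does not
    divide it. *)
Lemma irreducible_separable (F : realFieldType) (p : {poly F}) :
  irreducible_poly p -> separable_poly p.
Proof.
move=> irr_p; have [p_gt1 _] := irr_p.
rewrite unlock irreducible_poly_coprime //.
apply/negP => /dvdp_leq; rewrite -size_poly_eq0 polyorder.size_deriv.
by case: (size p) p_gt1 => [|[|k]] //= _ /(_ isT); rewrite ltnn.
Qed.

Lemma constant_on_conjugates (F : realFieldType) (L : closedFieldType)
    (iota : {rmorphism F -> L}) (p g : {poly F}) (c : L) :
    irreducible_poly p ->
    (forall z, root (map_poly iota p) z -> (map_poly iota g).[z] = c) ->
  exists a, iota a = c.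
Proof.
move=> irr_p g_const; have [p_gt1 _] := irr_p.
have nz_p : p != 0 by rewrite -size_poly_gt0 ltnW.
have [zs Dp] := closed_field_poly_normal (map_poly iota p).
have nz_lc : lead_coef (map_poly iota p) != 0.
  by rewrite lead_coef_eq0 map_poly_eq0.
have root_zs z : root (map_poly iota p) z = (z \in zs).
  by rewrite Dp rootZ // root_prod_XsubC.
have uniq_zs : uniq zs.
  have := irreducible_separable irr_p; rewrite -(separable_map iota) Dp.
  by rewrite (eqp_separable (eqp_scale _ nz_lc)) separable_prod_XsubC.
have size_zs : size p = (size zs).+1.
  by rewrite -(size_map_poly iota) Dp size_scale // size_prod_XsubC.
pose r := g %% p.
suff : map_poly iota r - c%:P = 0.
  move/eqP; rewrite subr_eq0 => /eqP Dr; exists r`_0.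
  by rewrite -coef_map Dr coefC.
apply: (@roots_geq_poly_eq0 _ _ zs) => //.
  apply/allP => z; rewrite -root_zs => pz; rewrite /root !hornerE subr_eq0.
  rewrite -(g_const z pz) {1}(divp_eq g p) rmorphD rmorphM /= hornerD hornerM.
  by rewrite (rootP pz) mulr0 add0r.
(* The constant [c%:P] may have size 1, so one root at least is required. *)
have zs_gt0 : (0 < size zs)%N by rewrite -ltnS -size_zs.
rewrite (leq_trans (size_polyD _ _)) // geq_max size_map_poly size_polyN.
rewrite -ltnS -size_zs ltn_modp nz_p /=.
by rewrite (leq_trans (size_polyC_leq1 _)).
Qed.

Local Notation pQtoC R := (map_poly (@ratr R[i])).

Section Hypergroup.
Variables (R : realType) (H : falgType R[i]) (n : nat).
Variable B : abelian_rational_RN_hypergroup H n.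

Local Notation x := (tnth (hbasis B)).
Local Notation dual := 'Hom(H, R[i]^o).
Local Notation QtoC := (@ratr R[i]).

Lemma hbasis_span (v : H) : exists a : 'I_n.+1 -> R[i], v = \sum_i a i *: x i.
Proof.
exists (fun i => coord (hbasis B) i v).
rewrite {1}(coord_basis (hbasisP B) (memvf v)).
by apply: eq_bigr => i _; rewrite (tnth_nth 0).
Qed.

Lemma coord_hbasis i j : coord (hbasis B) i (x j) = (j == i)%:R.
Proof. by rewrite (tnth_nth 0) coord_free // (basis_free (hbasisP B)). Qed.

Lemma hcoef0 i k : hcoef B ord0 i k = (i == k)%:R.
Proof.
have := congr1 (coord (hbasis B) k) (hbasisM B ord0 i).
rewrite hbasis0 mul1r coord_hbasis linear_sum (bigD1 k) //= big1 => [|j jk].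
  rewrite linearZ /= coord_hbasis eqxx addr0 mulr1 => E.
  by apply: (fmorph_inj QtoC); rewrite /= -E rmorph_nat.
by rewrite linearZ /= coord_hbasis (negPf jk) mulr0.
Qed.

(** By [hcoef0], [hcoef B ord0 j ord0] vanishes unless [j] is [ord0], yet it is positive at
    [j = hstar B ord0]. *)
Lemma hstar0 : hstar B ord0 = ord0.
Proof.
have := hcoef_star_gt0 B ord0; rewrite hcoef0.
by case: eqVneq => // _; rewrite ltxx.
Qed.

(** This turns being a character into polynomial equations with rational coefficients in the values
    on the basis, which Galois conjugation preserves. *)
Lemma characters_basis (f : dual) :
    characters f <-> f (x ord0) = 1 /\
    forall i j, f (x i) * f (x j) = \sum_k ratr (hcoef B i j k) * f (x k).
Proof.
split=> [/ahom_inP[fM f1]|[f1 fM]].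
  split=> [|i j]; first by rewrite hbasis0.
  rewrite -fM ?memvf // hbasisM linear_sum.
  by apply: eq_bigr => k _; rewrite linearZ.
apply/ahom_inP; split; last by rewrite -f1 hbasis0.
move=> u v _ _; have [[a ->] [b ->]] := (hbasis_span u, hbasis_span v).
rewrite !linear_sum !mulr_suml linear_sum /=; apply: eq_bigr => i _.
rewrite !mulr_sumr linear_sum /=; apply: eq_bigr => j _.
rewrite -scalerAl -scalerAr !linearZ /= -scalerAl -scalerAr.
congr (_ *: (_ *: _)); rewrite fM hbasisM linear_sum /=.
by apply: eq_bigr => k _; rewrite linearZ.
Qed.

(* The structure constants are the entries of a rational matrix having
   [f (x i)] as an eigenvalue, with eigenvector [(f (x k))_k]. *)
Lemma character_algebraic (f : dual) i :
  characters f -> algebraicOver QtoC (f (x i)).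
Proof.
move=> /characters_basis[f1 fM].
pose A : 'M[rat]_n.+1 := \matrix_(k, j) hcoef B i j k.
exists (char_poly A); first exact/monic_neq0/char_poly_monic.
rewrite map_char_poly -eigenvalue_root_char; apply/eigenvalueP.
exists (\row_k f (x k)).
  apply/rowP => j; rewrite !mxE fM; apply: eq_bigr => k _.
  by rewrite !mxE mulrC.
by apply/eqP => /rowP/(_ ord0)/eqP; rewrite !mxE f1 oner_eq0.
Qed.

(** Evaluating the grouplike identity at [x j] gives the formula up to the factor [dual_coef];
    whatever value was chosen for it, evaluation at the unit forces it to be 1. *)
Lemma dual_grouplike_mul_star (f : dual) i :
    (forall j, hdim B j != 0) -> characters f -> characters (FPdim B) ->
    dual_grouplike B f ->
  f (x i) * f (x (hstar B i)) = hdim B i ^+ 2.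
Proof.
move=> nz_d /characters_basis[f1 _] /characters_basis[d1 _] /lfunP E.
have {}E j : f (x j) * f (x (hstar B j)) =
    dual_coef B f (dual_star B f) (FPdim B) * hdim B j ^+ 2.
  have := E (x j); rewrite dual_extE scale_lfunE !linearZ /= dual_extE.
  have rescale (d a b : R[i]) :
      d != 0 -> a * b = d * (d^-1 * a * (d^-1 * b)) * d.
    by move=> d0; field.
  rewrite -/(hdim B j) [RHS]/GRing.scale /= expr2 mulrA => <-.
  exact: rescale.
have := E ord0; rewrite hstar0 f1 /hdim d1 expr1n !mulr1 => c1.
by rewrite E -c1 mul1r.
Qed.

End Hypergroup.

Theorem theorem1p13 (R : realType) (H : falgType R[i]) (n : nat)
    (B : abelian_rational_RN_hypergroup H n) :
  dual_Burnside B -> exists q : rat, FPdim_total B = ratr q.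
Proof.
move=> burnside.
have [[d_char d_gt0]|noFP] := pselect (is_FPdim B (FPdim B)); last first.
  (* Without a positive character, [FPdim] is the default value [0]. *)
  exists 0; rewrite rmorph0 /FPdim_total big1 // => i _.
  suff -> : hdim B i = 0 by rewrite expr0n mulr0.
  rewrite /hdim /FPdim; move: noFP; rewrite /FPdim.
  by case: xgetP => [f _ []//|_ _]; rewrite lfunE.
have nz_d i : hdim B i != 0 by rewrite gt_eqF ?d_gt0.
have [d1 dM] := (characters_basis B (FPdim B)).1 d_char.
have [|z alg_z gen_z] :=
    @primitive_element _ _ (@ratr R[i]) (codom (hdim B)) (pchar_num _).
  by move=> _ /codomP[i ->]; apply: character_algebraic.
have [p irr_p p_min] := exists_minpoly alg_z.
have /fin_all_exists[q Dq] i : exists q, (pQtoC R q).[z] = hdim B i.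
  exact/gen_z/codom_f.
pose g := \sum_i (hweight B i)%:P * q i * q (hstar B i).
suff [a <-] : exists a : rat, @ratr R[i] a = FPdim_total B by exists a.
apply: (@constant_on_conjugates _ _ (@ratr R[i]) p g) => // w pw.
(* A rational polynomial vanishing at [z] is a multiple of [p], hence vanishes at [w] too. *)
have conj r : (pQtoC R r).[z] = 0 -> (pQtoC R r).[w] = 0.
  move/rootP; rewrite p_min -(dvdp_map (@ratr R[i])) => dvd.
  exact/rootP/(root_dvdp dvd).
pose f := dual_ext B (fun i => (pQtoC R (q i)).[w]).
have fE i : f (tnth (hbasis B) i) = (pQtoC R (q i)).[w] by exact: dual_extE.
have f_char : characters f.
  apply/(characters_basis B); split=> [|i j].
    rewrite fE; apply/eqP; rewrite -subr_eq0.
    have := conj (q ord0 - 1); rewrite rmorphB rmorph1 !hornerE Dq.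
    by rewrite /hdim d1 subrr => ->.
  (* [r] vanishes at [z] because [FPdim] is multiplicative. *)
  pose r := q i * q j - \sum_k (hcoef B i j k)%:P * q k.
  have rE v : (pQtoC R r).[v] =
      (pQtoC R (q i)).[v] * (pQtoC R (q j)).[v] -
      \sum_k ratr (hcoef B i j k) * (pQtoC R (q k)).[v].
    rewrite rmorphB rmorphM rmorph_sum !hornerE horner_sum.
    congr (_ - _); apply: eq_bigr => k _.
    by rewrite rmorphM /= map_polyC hornerM hornerC.
  have : (pQtoC R r).[w] = 0.
    apply: conj; rewrite rE !Dq [_ * _]dM.
    by apply/eqP; rewrite subr_eq0; apply/eqP/eq_bigr => k _; rewrite Dq.
  rewrite rE => /eqP; rewrite subr_eq0 => /eqP Eij.
  by rewrite !fE [LHS]Eij; apply: eq_bigr => k _; rewrite fE.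
have nz_f i : f (tnth (hbasis B) i) != 0.
  rewrite fE; apply/negP => qw.
  (* Otherwise [p] divides [q i], and [hdim B i], the value of [q i] at [z], would be zero. *)
  have cop : coprimep p (q i).
    rewrite irreducible_poly_coprime // -p_min; apply/negP => /rootP qz.
    by have := nz_d i; rewrite -Dq qz eqxx.
  move: cop; rewrite -(coprimep_map (@ratr R[i])) => /coprimep_root/(_ pw).
  by rewrite (eqP qw) eqxx.
have f_grp : dual_grouplike B f.
  apply: contrapT => /(burnside f f_char).2[i fi0].
  by have := nz_f i; rewrite fi0 eqxx.
rewrite /g rmorph_sum horner_sum; apply: eq_bigr => i _.
rewrite !rmorphM /= map_polyC !hornerM hornerC /= -!fE -mulrA.
by rewrite dual_grouplike_mul_star.
Qed.
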